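(* Let $X$ be a complex Banach space and let $S,T\in B(X)$ be such that $ST=TS\in\tilde{\mathcal{F}}$. Then: (i) $\sigma_{dsc}(S+T)\setminus\{0\}\subseteq(\sigma_{dsc}(S)\cup\sigma_{dsc}(T))\setminus\{0\}$. (ii) $\mathcal{M}\cup\mathcal{N}\cup\big(\sigma_{dsc}(S+T)\setminus\{0\}\big)=\mathcal{M}\cup\mathcal{N}\cup\big((\sigma_{dsc}(S)\cup\sigma_{dsc}(T))\setminus\{0\}\big)$, where the sets $\mathcal{M},\mathcal{N}\subseteq\mathbb{C}$ (depending on $S,T$) are defined as follows. $\mathcal{M}$ is the set of all $\lambda\in\mathbb{C}$ such that: if $(S-\lambda)(T-\lambda)$ has finite descent, equal to $n_0$, then $\operatorname{codim}R((S-\lambda)^{n_0})$ is infinite or $\operatorname{codim}R((T-\lambda)^{n_0})$ is infinite. $\mathcal{N}$ is the set of all $\lambda\in\mathbb{C}$ such that: if $S+T-\lambda$ has finite descent, then the operators $A=S-\lambda$ and $B=T-\lambda$ fail to satisfy at least one of the following two properties: (a) $AB=BA$ and $N((BA)^p)=N(B^p)\oplus N(A^p)$ for all $p\in\mathbb{N}$; (b) $AB$ has finite descent, equal to some $n_0$, and $N(A^{n_0})\subseteq R(B)$ or $N(B^{n_0})\subseteq R(A)$.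
   Context: $B(X)$ is the algebra of bounded linear operators on $X$, and $N(T)$, $R(T)$ denote the null space and range of $T$. $\mathbb{N}=\{0,1,2,\dots\}$. The descent $dsc(T)$ is the smallest $n\in\mathbb{N}$ with $R(T^n)=R(T^{n+1})$, and $dsc(T)=\infty$ if no such $n$ exists. The descent spectrum is $\sigma_{dsc}(T)=\{\lambda\in\mathbb{C}: dsc(T-\lambda)=\infty\}$, where $T-\lambda$ means $T-\lambda I$. $\tilde{\mathcal{F}}$ is the set of all $F\in B(X)$ for which there exists $n_0\in\mathbb{N}$ such that $F^{n_0}$ has finite rank. $\operatorname{codim} R(T)=\dim X/R(T)$. The symbol $\oplus$ denotes the (internal algebraic) direct sum of subspaces, so that the equality includes the requirement that the two summands intersect only in $\{0\}$. *)

(* Defs.v *)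
From HB Require Import structures.
From mathcomp Require Import all_boot all_order all_algebra.
From mathcomp Require Import complex.
From mathcomp Require Import all_classical all_reals all_analysis.
Import Order.TTheory GRing.Theory Num.Theory.
Import numFieldNormedType.Exports.

Set Implicit Arguments.
Unset Strict Implicit.
Unset Printing Implicit Defensive.

Local Open Scope classical_set_scope.
Local Open Scope ring_scope.

Section Operators.
Context {R : realType} {X : completeNormedModType R[i]}.
Implicit Types (A B : X -> X) (U V W : set X) (S T F : {linear X -> X}).

Definition bounded_op A : Prop :=
  exists M : R[i], forall x, `|A x| <= M * `|x|.

Definition opow A (n : nat) : X -> X := iter n A.

Definition oker A : set X := [set x | A x = 0].

Definition oshift A (l : R[i]) : X -> X := fun x => A x - l *: x.

Definition fin_dim V : Prop :=
  exists (n : nat) (e : 'I_n -> X),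
    V = [set \sum_i c i *: e i | c in [set: 'I_n -> R[i]]].

(* dim X/W < oo for a subspace W: the classes of finitely many vectors e i
   span X/W, two vectors having the same class iff their difference is in W. *)
Definition fin_codim W : Prop :=
  exists (n : nat) (e : 'I_n -> X),
    forall x, exists c : 'I_n -> R[i], W (x - \sum_i c i *: e i).

(* Internal direct sum of subspaces: V = U (+) W. *)
Definition is_dsum V U W : Prop :=
  V = [set u + w | u in U & w in W] /\ U `&` W = [set 0].

Definition Ftilde F : Prop :=
  bounded_op F /\ exists n0 : nat, fin_dim (range (opow F n0)).

(* dsc(A) = n; infinite descent is the absence of any such n. *)
Definition descent_is A (n : nat) : Prop :=
  range (opow A n) = range (opow A n.+1) /\
  forall m, (m < n)%N -> range (opow A m) <> range (opow A m.+1).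

Definition finite_descent A : Prop := exists n : nat, descent_is A n.

Definition sigma_dsc A : set R[i] := [set l | ~ finite_descent (oshift A l)].

Definition setM S T : set R[i] :=
  [set l | forall n0 : nat,
     descent_is (oshift S l \o oshift T l) n0 ->
     ~ fin_codim (range (opow (oshift S l) n0)) \/
     ~ fin_codim (range (opow (oshift T l) n0))].

Definition property_a A B : Prop :=
  A \o B = B \o A /\
  forall p : nat,
    is_dsum (oker (opow (B \o A) p)) (oker (opow B p)) (oker (opow A p)).

Definition property_b A B : Prop :=
  exists2 n0 : nat, descent_is (A \o B) n0 &
    oker (opow A n0) `<=` range B \/ oker (opow B n0) `<=` range A.

Definition setN S T : set R[i] :=
  [set l | finite_descent (oshift (S \+ T) l) ->
     ~ property_a (oshift S l) (oshift T l) \/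
     ~ property_b (oshift S l) (oshift T l)].

End Operators.

(* Main.v *)
Require Import Defs.
From HB Require Import structures.
From mathcomp Require Import all_boot all_order all_algebra.
From mathcomp Require Import complex.
From mathcomp Require Import all_classical all_reals all_analysis.
Import Order.TTheory GRing.Theory Num.Theory.
Import numFieldNormedType.Exports.

Set Implicit Arguments.
Unset Strict Implicit.
Unset Printing Implicit Defensive.

Local Open Scope classical_set_scope.
Local Open Scope ring_scope.

(** Put A = S - l, B = T - l and F = ST, so that AB = F - l (S + T - l).
    If A and B have finite descent, so has AB, and it remains to remove the
    perturbation F.  For commuting f, g the binomial formula gives
    R((f + g)^(n+m)) <= R(f^n) + R(g^m), so that with E = R(F^m) of finite
    dimension the ranges of powers of AB and of AB - F agree up to E; a
    decreasing chain of subspaces that loses at most dim E dimensions is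
    stationary.  The same chain argument shows that outside of M the operators
    A and B always have finite descent: there R((AB)^n0) has finite codimension
    and is contained in R(A^n) and R(B^n) for every n.  Hence
    sigma_dsc(S) U sigma_dsc(T) is a subset of M, and the set N plays no role
    in (ii). *)

(* Otherwise choose x_i in W i \ W (i+1) for i <= r: these r+1 vectors are
   linearly dependent modulo W (r+1), and the first nonzero coefficient of a
   relation contradicts the choice of the corresponding x_i. *)
Lemma stationary_chain (K : fieldType) (V : lmodType K) (W : nat -> set V)
    (r : nat) (e : 'I_r -> V) :
  (forall n, W n 0) ->
  (forall n a x y, W n x -> W n y -> W n (a *: x + y)) ->
  (forall n, W n.+1 `<=` W n) ->
  (forall n x, W 0%N x -> exists c : 'I_r -> K, W n (x - \sum_i c i *: e i)) ->
  exists n, W n `<=` W n.+1.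
Proof.
move=> W0 Wlin Wdec Wcov; apply: contrapT => noW.
have Wle m n : (m <= n)%N -> W n `<=` W m.
  by move=> /subnK <-; elim: (n - m)%N => // k IH x /Wdec /IH.
have Wsum n (I : finType) (P : pred I) (a : I -> K) (y : I -> V) :
    (forall i, P i -> W n (a i *: y i)) -> W n (\sum_(i | P i) a i *: y i).
  move=> H; elim/big_ind: _ => // u v Wu Wv.
  by rewrite -[u]scale1r; apply: (Wlin).
have Wscale n a x : W n x -> W n (a *: x).
  by move=> Wx; rewrite -[_ *: _]addr0; apply: (Wlin).
have /choice[x xP] : forall n, exists x, W n x /\ ~ W n.+1 x.
  move=> n; apply: contrapT => Hn; apply: noW; exists n => y Wy.
  by apply: contrapT => nWy; apply: Hn; exists y.
have /choice[c cP] : forall i, exists c : 'I_r -> K,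
    W r.+1 (x i - \sum_j c j *: e j).
  by move=> i; apply: Wcov; apply: (Wle _ i) => //; case: (xP i).
(* [M] has one more row than it has columns, so its left kernel contains a nonzero row [a];
   combining the [x i] with weights [a] cancels every [e j]. *)
pose M := \matrix_(i < r.+1, j < r) c i j.
have [a aM a0] : exists2 a : 'rV[K]_r.+1, a *m M = 0 & a != 0.
  have : kermx M != 0.
    by rewrite -mxrank_eq0 mxrank_ker subn_eq0 -ltnNge ltnS rank_leq_col.
  by move=> /rowV0Pn[a /sub_kermxP aM a0]; exists a.
have Wax : W r.+1 (\sum_i a 0 i *: x i).
  have -> : \sum_i a 0 i *: x i =
      \sum_i a 0 i *: (x i - \sum_j c i j *: e j).
    rewrite (eq_bigr _ (fun i _ => scalerBr _ _ _)) sumrB.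
    rewrite [X in _ - X](_ : _ = 0) ?subr0//.
    rewrite (eq_bigr _ (fun i _ => scaler_sumr _ _ _ _)) exchange_big/=.
    apply: big1 => j _.
    have /matrixP/(_ 0 j) := aM; rewrite !mxE => aMj.
    transitivity ((\sum_i a 0 i * M i j) *: e j).
      by rewrite scaler_suml; apply: eq_bigr => i _; rewrite scalerA mxE.
    by rewrite aMj scale0r.
  by apply: (Wsum) => i _; apply: (Wscale); exact: cP.
have az n (i : 'I_r.+1) : (i < n)%N -> a 0 i = 0.
  elim: n i => // n IH i; rewrite ltnS leq_eqVlt => /predU1P[ein|/IH//].
  apply: contrapT => /eqP ai; case: (xP i) => _; apply.
  rewrite -[x i]scale1r -(mulVf ai) -scalerA; apply: (Wscale).
  have -> : a 0 i *: x i =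
      (-1) *: (\sum_(j | j != i) a 0 j *: x j) + \sum_j a 0 j *: x j.
    by rewrite [\sum_j _](bigD1 i)//= scaleN1r addrCA addNr addr0.
  (* Each piece lies in [W i.+1]: the terms before [i] vanish by induction, the later [x j] lie in
     [W j], and the full combination lies in [W r.+1]. *)
  apply: (Wlin); last by apply: (Wle _ r.+1).
  apply: (Wsum) => j ji.
  have [jn|] := ltnP j n; first by rewrite IH// scale0r.
  rewrite -ein leq_eqVlt eq_sym val_eqE (negPf ji)/= => ij.
  by apply: (Wscale); apply: (Wle _ _ ij); case: (xP j).
by case/eqP: a0; apply/rowP => i; rewrite mxE (az r.+1).
Qed.

(** * Iterates of commuting maps and the binomial splitting *)

Section Iterates.
Context {K : comNzRingType} {V : lmodType K}.
Implicit Types (f g h : {linear V -> V}) (u v : V -> V).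

Lemma iter_comm u v n : u \o v = v \o u ->
  forall x, iter n u (v x) = v (iter n u x).
Proof.
by move=> /funeqP uv x; elim: n => //= n ->; exact: uv.
Qed.

Lemma iter_comp_comm u v n : u \o v = v \o u ->
  forall x, iter n (u \o v) x = iter n u (iter n v x).
Proof.
move=> uv x; elim: n => //= n ->.
by rewrite [in RHS](iter_comm _ uv).
Qed.

Lemma iter_lin f n a x y :
  iter n f (a *: x + y) = a *: iter n f x + iter n f y.
Proof. by elim: n => //= n ->; rewrite linearP. Qed.

Lemma iter0 f n : iter n f 0 = 0.
Proof. by elim: n => //= n ->; rewrite linear0. Qed.

Lemma iter_sum f n (I : finType) (a : I -> K) (x : I -> V) :
  iter n f (\sum_i a i *: x i) = \sum_i a i *: iter n f (x i).
Proof.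
elim: n => //= n ->; rewrite linear_sum.
by apply: eq_bigr => i _; rewrite linearZ.
Qed.

Lemma iter_scale f a n x :
  iter n (fun y => a *: f y) x = a ^+ n *: iter n f x.
Proof.
elim: n => [|n /= ->]; first by rewrite expr0 scale1r.
by rewrite linearZ/= scalerA -exprS.
Qed.

Lemma range_iter_le u m n : (m <= n)%N -> range (iter n u) `<=` range (iter m u).
Proof.
by move=> mn _ [x _ <-]; rewrite -(subnKC mn) iterD; exists (iter (n - m) u x).
Qed.

Lemma range_iter_stationary u d : range (iter d u) `<=` range (iter d.+1 u) ->
  forall n, range (iter d u) `<=` range (iter n u).
Proof.
move=> ud n; have [nd|/ltnW dn] := leqP n d; first exact: range_iter_le.
rewrite -(subnK dn); elim: (n - d)%N => // k IH _ [x _ <-].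
have [|y _ <-] := ud (iter d u x); first by exists x.
rewrite iterS.
have [|z _ <-] := IH (iter d u y); first by exists y.
by exists z => //; rewrite addSn.
Qed.

(** Each binomial term contains f^n or g^m as a factor. Induction on [n + m] avoids the
    coefficients: the outermost [f] acts on the splitting for [(n, m.+1)], the outermost [g] on the
    one for [(n.+1, m)]. *)
Lemma iter_add_comm f g : f \o g = g \o f :> (V -> V) ->
  forall n m x, exists y z, iter (n + m) (f \+ g) x = iter n f y + iter m g z.
Proof.
move=> fg n m x; have [k] := ubnP (n + m)%N.
elim: k n m x => // k IH [|n] [|m] x nmk.
- by exists x, 0; rewrite /= addr0.
- by exists (iter m.+1 (f \+ g) x), 0; rewrite iter0 addr0.
- by exists 0, (iter n.+1 (f \+ g) x); rewrite addn0 iter0 add0r.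
have [|y [z yz]] := IH n m.+1 x; first by rewrite addSn in nmk.
have [|y' [z' yz']] := IH n.+1 m x; first by rewrite addnS in nmk.
exists (y + g y'), (f z + z').
have -> : (n.+1 + m.+1 = (n + m.+1).+1)%N by rewrite addSn.
rewrite iterS /GRing.add_fun {1}yz addnS -addSn yz' !linearD.
have -> : iter n.+1 f (y + g y') = f (iter n f y) + g (iter n.+1 f y').
  by rewrite -[y]scale1r iter_lin !scale1r (iter_comm _ fg).
have -> : iter m.+1 g (f z + z') = f (iter m.+1 g z) + g (iter m g z').
  by rewrite -[f z]scale1r iter_lin !scale1r (iter_comm _ (esym fg)).
by rewrite -!addrA; congr (_ + _); rewrite addrCA.
Qed.

End Iterates.

(** * Finite descent of products, perturbations and factors *)

Section Descent.
Context {R : realType} {X : completeNormedModType R[i]}.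
Implicit Types (f g h : {linear X -> X}) (u v : X -> X).

Lemma finite_descentP u :
  finite_descent u <-> exists n, range (iter n u) `<=` range (iter n.+1 u).
Proof.
split=> [[n [un _]]|un]; first by exists n; rewrite -/(opow u n) un.
have exP : exists n, `[< range (iter n u) `<=` range (iter n.+1 u) >].
  by case: un => n nP; exists n; apply/asboolP.
case: (ex_minnP exP) => n /asboolP nP nmin; exists n; split.
  by apply/seteqP; split => //; exact: range_iter_le.
move=> m mn um; have : (n <= m)%N.
  by apply: nmin; apply/asboolP; rewrite -/(opow u m) um.
by rewrite leqNgt mn.
Qed.

Lemma finite_descent_scale f a : a != 0 ->
  finite_descent (fun x => a *: f x) -> finite_descent f.
Proof.
move=> a0 /finite_descentP[n afn]; apply/finite_descentP; exists n => _ [x _ <-].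
have [|y _] := afn (a ^+ n *: iter n f x); first by exists x; rewrite ?iter_scale.
rewrite iter_scale exprSr -scalerA => /(scalerI (expf_neq0 n a0)) <-.
exists (a *: y) => //.
by rewrite -[a *: y]addr0 iter_lin iter0 addr0.
Qed.

(** With n the larger of the two stationary indices, v^n x = v^(n+1) y and u^n y = u^(n+1) z;
    commuting the powers gives (uv)^n x = (uv)^(n+1) z. *)
Lemma finite_descent_comp u v : u \o v = v \o u ->
  finite_descent u -> finite_descent v -> finite_descent (u \o v).
Proof.
move=> uv /finite_descentP[p up] /finite_descentP[q vq].
apply/finite_descentP; exists (maxn p q) => _ [x _ <-].
set n := maxn p q; rewrite iter_comp_comm//.
have /(range_iter_stationary vq n.+1)[y _ <-] : range (iter q v) (iter n v x).
  by apply: (range_iter_le (leq_maxr p q)); exists x.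
have /(range_iter_stationary up n.+1)[z _ uz] : range (iter p u) (iter n u y).
  by apply: (range_iter_le (leq_maxl p q)); exists y.
exists z => //; rewrite uv iter_comp_comm ?uz; last exact/esym.
have cn : u \o iter n.+1 v = iter n.+1 v \o u.
  by apply/funext => t /=; rewrite -!iterS (iter_comm _ (esym uv)).
by rewrite (iter_comm _ cn).
Qed.

(** The vectors [e] do not depend on [n], so every quotient R(f^k)/R(f^n) with n >= k has dimension
    at most [r]. *)
Lemma finite_descent_of_cover f k r (e : 'I_r -> X) :
  (forall n x, range (iter k f) x ->
     exists c : 'I_r -> R[i], range (iter n f) (x - \sum_i c i *: e i)) ->
  finite_descent f.
Proof.
move=> fe; apply/finite_descentP.
suff [n nP] : exists n, range (iter (k + n) f) `<=` range (iter (k + n).+1 f).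
  by exists (k + n)%N.
have [||||n nP] := @stationary_chain _ _ (fun n => range (iter (k + n) f)) r e.
- by move=> n; exists 0 => //; rewrite iter0.
- move=> n a _ _ [x _ <-] [y _ <-].
  by exists (a *: x + y) => //; rewrite iter_lin.
- by move=> n; apply: range_iter_le; rewrite addnS.
- by move=> n x; rewrite addn0 => /fe; apply.
- by exists n; rewrite -addnS.
Qed.

(** With h = f + g and E = R(g^m), splitting f = h - g and then h = f + g gives R(f^(d+m)) <= R(h^d)
    + E = R(h^(n+m)) + E <= R(f^n) + E for every n. *)
Lemma finite_descent_perturb f g m : f \o g = g \o f :> (X -> X) ->
  fin_dim (range (iter m g)) -> finite_descent (f \+ g) -> finite_descent f.
Proof.
move=> fg [r [e eP]] /finite_descentP[d hd].
apply: (@finite_descent_of_cover f (d + m) r e) => n _ [x _ <-].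
pose h : {linear X -> X} := f \+ g; pose g' : {linear X -> X} := -1 \*: g.
have hg' : h \o g' = g' \o h :> (X -> X).
  apply/funext => t; rewrite /h /g'/= !linearD !linearZ_LR.
  by have /= -> := congr1 (@^~ t) fg.
have -> : iter (d + m) f x = iter (d + m) (h \+ g') x.
  by apply: eq_iter => t; rewrite /h /g'/= scaleN1r addrK.
have [y [z ->]] := iter_add_comm hg' d m x.
have /(range_iter_stationary hd (n + m))[t _ <-] :
  range (iter d h) (iter d h y) by exists y.
have [s [w ->]] := iter_add_comm fg n m t.
(* The components in E from both splittings are gathered into one vector; the sign comes from
   (-g)^m. *)
have : range (iter m g) (iter m g ((-1) ^+ m *: z + w)) by eexists.
rewrite eP => -[c _ cE]; exists c; rewrite cE iter_lin.
exists s => //.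
have -> : iter m g' z = (-1) ^+ m *: iter m g z by rewrite -iter_scale.
by rewrite opprD addrA !addrK.
Qed.

Lemma finite_descent_factor f g n : f \o g = g \o f :> (X -> X) ->
  descent_is (f \o g) n ->
  fin_codim (range (opow f n)) -> fin_codim (range (opow g n)) ->
  finite_descent f.
Proof.
move=> fg [hn _] [p [e eP]] [q [e' eP']].
(* Modulo the [e j], x is f^n y, and modulo the [e' j], y is g^n z. So the [e j] and f^n ([e' j])
   together span X modulo R((fg)^n), which lies in R(f^k) for all k. *)
pose E (i : 'I_(p + q)) : X :=
  match fintype.split i with inl j => e j | inr j => iter n f (e' j) end.
apply: (@finite_descent_of_cover f 0 _ E) => k x _.
have [c [y _ yE]] := eP x; have [c' [z _ zE]] := eP' y.
pose b (i : 'I_(p + q)) := match fintype.split i with inl j => c j | inr j => c' j end.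
exists b.
have hs : range (iter n (f \o g)) `<=` range (iter n.+1 (f \o g)).
  by rewrite -/(opow (f \o g) n) hn.
have /(range_iter_stationary hs k)[w _ wE] :
  range (iter n (f \o g)) (iter n (f \o g) z) by exists z.
exists (iter k g w) => //; rewrite -iter_comp_comm// wE iter_comp_comm//.
have -> : \sum_i b i *: E i =
    \sum_i c i *: e i + \sum_i c' i *: iter n f (e' i).
  rewrite big_split_ord/=; congr (_ + _); apply: eq_bigr => i _; rewrite /b /E.
    by rewrite (unsplitK (inl i)).
  by rewrite (unsplitK (inr i)).
have {}yE : iter n f y = x - \sum_i c i *: e i := yE.
have {}zE : iter n g z = y - \sum_i c' i *: e' i := zE.
by rewrite opprD addrA -yE -iter_sum zE [y - _]addrC -scaleN1r iter_lin scaleN1r addrC.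
Qed.

End Descent.

Theorem corollary1p6 (R : realType) (X : completeNormedModType R[i])
  (S T : {linear X -> X})
  (hS : bounded_op S) (hT : bounded_op T)
  (hcomm : S \o T = T \o S :> (X -> X))
  (hF : Ftilde (S \o T)) :
  sigma_dsc (S \+ T) `\ 0 `<=` (sigma_dsc S `|` sigma_dsc T) `\ 0 /\
  setM S T `|` setN S T `|` (sigma_dsc (S \+ T) `\ 0) =
  setM S T `|` setN S T `|` ((sigma_dsc S `|` sigma_dsc T) `\ 0).
Proof.
have ST x : S (T x) = T (S x) by move/funeqP: hcomm => /(_ x).
pose A l : {linear X -> X} := S \- l \*: idfun.
pose B l : {linear X -> X} := T \- l \*: idfun.
have AB l : A l \o B l = B l \o A l :> (X -> X).
  apply/funext => x; rewrite /A /B/= !linearB !linearZ_LR/= ST.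
  exact: addrACA.
have sub : sigma_dsc (S \+ T) `\ 0 `<=` (sigma_dsc S `|` sigma_dsc T) `\ 0.
  move=> l [/= STl l0]; split => //; apply: contrapT => /not_orP.
  move=> [/contrapT Sl /contrapT Tl]; apply: STl.
  have {}l0 : - l != 0 by rewrite oppr_eq0; apply/eqP.
  pose U : {linear X -> X} := (S \+ T) \- l \*: idfun.
  (* This is AB - F, so [f \+ F] is the product AB; since l is nonzero, [f] and [U] have the same
     ranges of powers. *)
  pose f : {linear X -> X} := - l \*: U.
  pose F : {linear X -> X} := S \o T.
  apply: (@finite_descent_scale _ _ U (- l)) => //.
  have [_ [m Fm]] := hF.
  apply: (@finite_descent_perturb _ _ f F m) => //.
    have US (P : {linear X -> X}) x : P (S x) = S (P x) -> P (T x) = T (P x) ->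
        P (f x) = f (P x).
      move=> PS PT; rewrite /f /U/= linearZ_LR [P (_ - _)]linearB.
      by rewrite [P (_ + _)]linearD [P (_ *: _)]linearZ_LR PS PT.
    apply/funext => x; apply/esym/(etrans (congr1 S (US T x _ _))) => //.
    exact: US.
  rewrite [X in finite_descent X](_ : _ = A l \o B l).
    exact: finite_descent_comp.
  apply/funext => x; rewrite /f /F /U /A /B/= [S (_ - _)]linearB.
  rewrite [S (_ *: _)]linearZ_LR/= -addrA scaleNr scalerDr opprD.
  by rewrite -[RHS]addrA [RHS]addrC.
split => //.
have subM : sigma_dsc S `|` sigma_dsc T `<=` setM S T.
  move=> l dsc n ABn; apply: contrapT => /not_orP[/contrapT An /contrapT Bn].
  case: dsc; apply.
    exact: (@finite_descent_factor _ _ (A l) (B l) n).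
  apply: (@finite_descent_factor _ _ (B l) (A l) n) => //.
  by rewrite -AB.
apply/seteqP; split => l [?|]; [by left| |by left|].
  by move=> /sub; right.
by move=> -[/subM ? _]; left; left.
Qed.
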